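(* Let $n\ge 1$. There are $n$ coins, each of which has one of three possible weights $w_1<w_2<w_3$, and a balance scale on which each pan holds only one coin. Then there is a strategy that sorts the coins and requires not more than $\lceil 3n/2\rceil-2$ weighings.
   Context: The coins are labelled and look identical; the assignment of the weights $w_1<w_2<w_3$ to the coins is unknown and arbitrary (in particular, not all three weights need occur), and the numerical values of the weights are unknown. A weighing on a balance scale with tiny pans (each pan fits only one coin) compares one coin against one other coin and reports whether the two weigh the same, the left one is lighter, or the left one is heavier. A strategy is adaptive: each weighing may depend on the outcomes of the previous ones. To sort the coins means to determine the partition of the coins into groups such that coins in the same group weigh the same, coins in different groups have different weights, and for every two groups it is known which one contains the lighter coins. A strategy sorts the coins in at most $m$ weighings if, for all weights $w_1<w_2<w_3$ and every assignment of them to the coins, it uses at most $m$ weighings and its outcomes determine the sorting. *)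

(* Defs.v *)
From HB Require Import structures.
From mathcomp Require Import all_boot all_order all_algebra.
From mathcomp Require Import reals.

Set Implicit Arguments.
Unset Strict Implicit.
Unset Printing Implicit Defensive.

Import Order.TTheory GRing.Theory Num.Theory.
Local Open Scope ring_scope.

Variant outcome := Balanced | LeftLighter | LeftHeavier.

Definition weigh (R : realType) (l r : R) : outcome :=
  if l < r then LeftLighter else if r < l then LeftHeavier else Balanced.

(* Adaptivity: the rest of the strategy is a function of the last outcome.
   The tree mentions only coin labels, so a strategy cannot depend on the
   weights except through the outcomes. *)
Inductive strategy (n : nat) : Type :=
| Stop
| Weigh (l r : 'I_n) (l_neq_r : l != r) (next : outcome -> strategy n).

(* The outcomes observed, in order; the number of weighings used is its size. *)
Fixpoint transcript (R : realType) (n : nat) (S : strategy n)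
    (x : 'I_n -> R) : seq outcome :=
  match S with
  | Stop => [::]
  | Weigh l r _ next =>
      let o := weigh (x l) (x r) in o :: transcript (next o) x
  end.

(* [gs] lists the groups from lightest to heaviest.  The groups are nonempty
   (by [partition]), so the last clause also excludes repetitions in [gs]. *)
Definition is_sorting (R : realType) (n : nat) (x : 'I_n -> R)
    (gs : seq {set 'I_n}) : Prop :=
  [/\ partition [set G in gs] [set: 'I_n],
      forall G : {set 'I_n}, G \in gs -> {in G &, forall i j, x i = x j}
    & pairwise (fun G H : {set 'I_n} =>
                  [forall i in G, forall j in H, x i < x j]) gs].

(* The function [answer] reads the sorting off the outcomes alone: it is chosen
   before the weights and their assignment [x] to the coins. *)
Definition sorts_in_at_most (R : realType) (n : nat) (S : strategy n)
    (m : nat) : Prop :=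
  exists answer : seq outcome -> seq {set 'I_n},
    forall w1 w2 w3 : R, w1 < w2 -> w2 < w3 ->
    forall x : 'I_n -> R, (forall i, x i \in [:: w1; w2; w3]) ->
      (size (transcript S x) <= m)%N /\ is_sorting x (answer (transcript S x)).

(* Main.v *)
(** Keep a sorted list of representatives, one for each weight seen so far.  Two
    new coins are sorted into it with three weighings: they are first compared
    with each other, and then at most two comparisons with representatives are
    needed, because only three weights exist.  For odd [n] start from a single
    coin, at no cost; for even [n] start from two coins and one weighing. *)

Require Import Defs.
From mathcomp Require Import all_boot all_order all_algebra.
From mathcomp Require Import reals zify.

Set Implicit Arguments.
Unset Strict Implicit.
Unset Printing Implicit Defensive.

Import Order.TTheory.

Section TinyPans.

Variables (R : realType) (n : nat).

Implicit Types (f : 'I_n -> nat) (cs s : seq 'I_n) (h : 'I_n -> 'I_n).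
Implicit Types (I J : ('I_n -> nat) -> Prop).

(** * Ranks in place of weights *)

Definition is_rank (x : 'I_n -> R) f : Prop :=
  (forall i, f i < 3) /\ forall i j, (x i < x j)%R = (f i < f j).

Lemma is_rank_eq x f i j : is_rank x f -> f i = f j -> x i = x j.
Proof.
move=> [_ xf] fij; apply: le_anti.
by rewrite !leNgt !xf fij ltnn.
Qed.

(** Ranks below 3 turn every later comparison of weights into arithmetic that [lia] decides. A
    weight that no coin has merely leaves a gap among the ranks. *)
Lemma rank_exists (w1 w2 w3 : R) (x : 'I_n -> R) :
  (w1 < w2)%R -> (w2 < w3)%R -> (forall i, x i \in [:: w1; w2; w3]) ->
  exists f, is_rank x f.
Proof.
move=> w12 w23 xw.
exists (fun i => index (x i) [:: w1; w2; w3]); split=> [i|i j].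
  by rewrite -[3]/(size [:: w1; w2; w3]) index_mem.
have srt : sorted <%R [:: w1; w2; w3] by rewrite /= w12 w23.
rewrite -[in LHS](nth_index w1 (xw i)) -[in LHS](nth_index w1 (xw j)).
by rewrite (lt_sorted_ltn_nth w1 srt) ?inE ?index_mem.
Qed.

(** * Strategies relative to partial knowledge *)

(* [I] is what is already known about the ranks of the coins. *)
Definition sortable I (m : nat) : Prop :=
  exists (S : strategy n) (answer : seq outcome -> seq {set 'I_n}),
    forall x f, is_rank x f -> I f ->
      size (transcript S x) <= m /\ is_sorting x (answer (transcript S x)).

Lemma sortable_weaken I J m k :
  (forall f, (forall i, f i < 3) -> I f -> J f) -> m <= k ->
  sortable J m -> sortable I k.
Proof.
move=> IJ mk [S [answer SP]]; exists S, answer => x f xf If.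
have [le_m srt] := SP x f xf (IJ f xf.1 If).
by split=> //; apply: leq_trans mk.
Qed.

Lemma sortable_stop I gs :
  (forall x f, is_rank x f -> I f -> is_sorting x gs) -> sortable I 0.
Proof. by move=> gsP; exists (Stop n), (fun=> gs) => x f xf /(gsP x f xf). Qed.

Lemma sortable_absurd I m :
  (forall f, (forall i, f i < 3) -> ~ I f) -> sortable I m.
Proof.
move=> notI; apply: (sortable_weaken (J := fun=> False) notI (leq0n m)).
exact: (@sortable_stop _ [::]).
Qed.

(** Each outcome adds one fact to [I], so a strategy can be built branch by branch without further
    mention of transcripts. *)
Lemma sortable_weigh I m (l r : 'I_n) : l != r ->
  sortable (fun f => I f /\ f l < f r) m ->
  sortable (fun f => I f /\ f l = f r) m ->
  sortable (fun f => I f /\ f r < f l) m ->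
  sortable I m.+1.
Proof.
move=> lr [S1 [A1 P1]] [S2 [A2 P2]] [S3 [A3 P3]].
exists (Weigh lr (fun o => match o with
   LeftLighter => S1 | Balanced => S2 | LeftHeavier => S3 end)).
exists (fun t => if t is o :: t' then
   match o with
   LeftLighter => A1 t' | Balanced => A2 t' | LeftHeavier => A3 t' end
   else [::]).
move=> x f xf If; rewrite /= /weigh !xf.2.
case: (ltngtP (f l) (f r)) => flr /=; rewrite ltnS.
- exact: P1 xf (conj If flr).
- exact: P3 xf (conj If flr).
- exact: P2 xf (conj If flr).
Qed.

(** * Representatives and unsorted coins *)

(* [cs] are the coins not yet sorted, [s] the representatives from lightest to
   heaviest, and [h] sends each sorted coin to its representative. *)
Definition known cs s h f : Prop :=
  pairwise (fun i j => f i < f j) s /\ forall i, i \notin cs -> f i = f (h i).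


Lemma pairwise_ltn_inj f s :
  pairwise (fun i j => f i < f j) s -> {in s &, injective f}.
Proof.
elim: s => //= a s IHs /andP[/allP lt_a /IHs s_inj] i j; rewrite !inE.
case/predU1P=> [->|si] /predU1P[->|sj] // fij; last exact: s_inj.
- by have := lt_a j sj; rewrite fij ltnn.
- by have := lt_a i si; rewrite fij ltnn.
Qed.

Lemma sortable_known s h : (forall i, h i \in s) -> sortable (known [::] s h) 0.
Proof.
move=> hs.
apply: (@sortable_stop _ [seq [set i | h i == r] | r <- s]) => x f xf.
case=> srt fh; have s_inj := pairwise_ltn_inj srt.
(* The groups are the fibres of [h] over [s]. Each is nonempty because it contains its
   representative: [r] and [h r] both lie in [s] and have equal rank. *)
have hK r : r \in s -> h r = r by move=> sr; apply: s_inj => //; rewrite -fh.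
split.
- suff -> : [set G in [seq [set i | h i == r] | r <- s]]
            = preim_partition h [set: 'I_n] by apply: preim_partitionP.
  apply/setP=> G; rewrite inE; apply/mapP/imsetP => [[r sr ->]|[i _ ->]].
    by exists r => //; apply/setP=> i; rewrite !inE (hK r sr) eq_sym.
  by exists (h i) => //; apply/setP=> j; rewrite !inE eq_sym.
- move=> _ /mapP[r _ ->] i j; rewrite !inE => /eqP hi /eqP hj.
  by apply: is_rank_eq xf _; rewrite fh // [RHS]fh // hi hj.
- rewrite pairwise_map; apply: sub_pairwise srt => r t /= lt_rt.
  apply/forall_inP=> i; rewrite inE => /eqP hi.
  apply/forall_inP=> j; rewrite inE => /eqP hj.
  by rewrite xf.2 fh // [f j]fh // hi hj.
Qed.

(** Ranging over all [s] and [h] makes the bound depend on the unsorted coins only, so one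
    hypothesis serves every leaf of the decision tree. *)
Definition completable cs (m : nat) : Prop :=
  forall s h, s != [::] -> all (fun i => i \notin cs) s ->
  (forall i, i \notin cs -> h i \in s) -> sortable (known cs s h) m.

Lemma completable_nil : completable [::] 0.
Proof. by move=> s h _ _ hs; apply: sortable_known => i; apply: hs. Qed.

(** A leaf of the decision tree for the pair [a], [b]: [s'] is the updated list of representatives,
    and [h] is extended by [ra] and [rb]. The last premise isolates the arithmetic of ranks. *)
Lemma sortable_insert I cs s s' h (a b ra rb : 'I_n) m k :
  completable cs m -> m <= k -> uniq [:: a, b & cs] ->
  all (fun i => i \notin [:: a, b & cs]) s ->
  (forall i, i \notin [:: a, b & cs] -> h i \in s) ->
  all (fun i => i \in [:: a, b & s]) s' ->
  all (fun i => i \in s') s -> ra \in s' -> rb \in s' ->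
  (forall f, (forall i, f i < 3) -> I f ->
     [/\ known [:: a, b & cs] s h f, pairwise (fun i j => f i < f j) s',
         f a = f ra & f b = f rb]) ->
  sortable I k.
Proof.
move=> cs_m mk ab_cs /allP s_cs hs /allP s's /allP ss' s'a s'b IP.
pose h' i := if i == a then ra else if i == b then rb else h i.
have s'cs : all (fun i => i \notin cs) s'.
  apply/allP=> i /s's; case/and3P: ab_cs; rewrite inE negb_or => /andP[_ ?] ? _.
  rewrite !inE => /or3P[/eqP->|/eqP->|/s_cs] //.
  by rewrite !inE !negb_or => /and3P[].
apply: sortable_weaken mk (cs_m s' h' _ s'cs _) => [f f3 If||i i_cs].
- have [[_ fh] srt fa fb] := IP f f3 If; split=> // i i_cs; rewrite /h'.
  case: eqVneq => [->//|ia]; case: eqVneq => [->//|ib].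
  by apply: fh; rewrite !inE !negb_or ia ib.
- by case: (s') s'a.
- rewrite /h'; case: eqVneq => [//|ia]; case: eqVneq => [//|ib].
  by apply/ss'/hs; rewrite !inE !negb_or ia ib.
Qed.

(** * Inserting a pair of coins *)

(* In branches that three weights rule out, the hypotheses are contradictory and
   the arguments of [insert] are arbitrary. *)
Ltac insert s' ra rb :=
  lazymatch goal with
    cs_m : completable ?cs _, ab_cs : is_true (uniq [:: ?a, ?b & _]),
    s_cs : is_true (all _ ?s),
    hs : forall i, _ -> is_true (?h i \in _) |- _ =>
    apply: (@sortable_insert _ _ _ s' _ _ _ ra rb _ _ cs_m _ ab_cs s_cs hs);
    [ lia
    | by rewrite /= ?inE ?eqxx ?orbT
    | by rewrite /= ?inE ?eqxx ?orbT
    | by rewrite !inE eqxx ?orbT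
    | by rewrite !inE eqxx ?orbT
    | let f := fresh "f" in let f3 := fresh "f3" in let Hf := fresh "Hf" in
      let kn := fresh "kn" in let s3 := fresh "s3" in
      intros f f3 Hf;
      (have kn : known [:: a, b & cs] s h f by tauto);
      (have s3 : all (fun i => f i < 3) s by apply/allP=> ? _; apply: f3);
      move: Hf (f3 a) (f3 b) s3; case: (kn) => + _; clear -kn;
      rewrite /= ?andbT => *; split; [exact: kn | lia | lia | lia] ]
  end.

(** One coin stands for both. It meets the representatives in turn, from the lightest, while at most
    two are known; once there are three, the middle one suffices. *)
Lemma sortable_eq_pair cs m s h (a b : 'I_n) :
  completable cs m -> uniq [:: a, b & cs] -> s != [::] ->
  all (fun i => i \notin [:: a, b & cs]) s ->
  (forall i, i \notin [:: a, b & cs] -> h i \in s) ->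
  sortable (fun f => known [:: a, b & cs] s h f /\ f a = f b) m.+2.
Proof.
case: s => [//|r [|t [|u [|v s]]]] cs_m ab_cs _ s_cs hs.
- have ar : a != r by move: s_cs; rewrite /= !inE ![r == _]eq_sym; lia.
  apply: (sortable_weigh ar).
  + insert [:: a; r] a a.
  + insert [:: r] r r.
  + insert [:: r; a] a a.
- have [ar at_] : a != r /\ a != t.
    by move: s_cs; rewrite /= !inE ![_ == a]eq_sym; lia.
  apply: (sortable_weigh ar).
  + insert [:: a; r; t] a a.
  + insert [:: r; t] r r.
  + apply: (sortable_weigh at_).
    * insert [:: r; a; t] a a.
    * insert [:: r; t] t t.
    * insert [:: r; t; a] a a.
- have at_ : a != t by move: s_cs; rewrite /= !inE ![_ == a]eq_sym; lia.
  apply: (sortable_weigh at_).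
  + insert [:: r; t; u] r r.
  + insert [:: r; t; u] t t.
  + insert [:: r; t; u] u u.
(* A fourth representative would have rank at least 3. *)
- apply: sortable_absurd => f f3 [[srt _] _].
  by move: srt (f3 v) => /=; lia.
Qed.

Lemma sortable_lt_pair cs m s h (a b : 'I_n) :
  completable cs m -> uniq [:: a, b & cs] -> s != [::] ->
  all (fun i => i \notin [:: a, b & cs]) s ->
  (forall i, i \notin [:: a, b & cs] -> h i \in s) ->
  sortable (fun f => known [:: a, b & cs] s h f /\ f a < f b) m.+2.
Proof.
case: s => [//|r [|t [|u [|v s]]]] cs_m ab_cs _ s_cs hs.
- have [ar br] : a != r /\ b != r.
    by move: s_cs; rewrite /= !inE ![r == _]eq_sym; lia.
  apply: (sortable_weigh ar).
  + apply: (sortable_weigh br).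
    * insert [:: a; b; r] a b.
    * insert [:: a; r] a r.
    * insert [:: a; r; b] a b.
  + insert [:: r; b] r b.
  + insert [:: r; a; b] a b.
- have /and4P[ar at_ br bt] : [&& a != r, a != t, b != r & b != t].
    by move: s_cs; rewrite /= !inE ![_ == a]eq_sym ![_ == b]eq_sym; lia.
  apply: (sortable_weigh ar).
  (* Now [a], [r], [t] show all three weights, and [b] is heavier than [a], so comparing it with the
     middle one places it. *)
  + apply: (sortable_weigh br).
    * insert [:: a; r; t] a a.
    * insert [:: a; r; t] a r.
    * insert [:: a; r; t] a t.
  + apply: (sortable_weigh bt).
    * insert [:: r; b; t] r b.
    * insert [:: r; t] r t.
    * insert [:: r; t; b] r b.
  (* Now [r], [a], [b] show all three weights, so [t] weighs the same as [a] or as [b], and one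
     weighing decides which. *)
  + apply: (sortable_weigh at_).
    * insert [:: r; a; t] a t.
    * insert [:: r; t; b] t b.
    * insert [:: r; t] t t.
- have [at_ bt] : a != t /\ b != t.
    by move: s_cs; rewrite /= !inE ![_ == a]eq_sym ![_ == b]eq_sym; lia.
  apply: (sortable_weigh at_).
  + apply: (sortable_weigh bt).
    * insert [:: r; t; u] r r.
    * insert [:: r; t; u] r t.
    * insert [:: r; t; u] r u.
  + insert [:: r; t; u] t u.
  + insert [:: r; t; u] u u.
- apply: sortable_absurd => f f3 [[srt _] _].
  by move: srt (f3 v) => /=; lia.
Qed.

Lemma completable_pair cs m (a b : 'I_n) :
  uniq [:: a, b & cs] -> completable cs m ->
  completable [:: a, b & cs] m.+3.
Proof.
move=> ab_cs cs_m s h s0 s_cs hs.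
have /= /andP[] := ab_cs; rewrite inE negb_or => /andP[ab _] _.
have mem_swap i : (i \in [:: b, a & cs]) = (i \in [:: a, b & cs]).
  by rewrite !inE orbCA.
apply: (sortable_weigh ab).
- exact: sortable_lt_pair.
- exact: sortable_eq_pair.
(* Exchanging the names of the two coins reduces this branch to the first one. *)
- apply: (@sortable_weaken _ (fun f => known [:: b, a & cs] s h f /\ f b < f a)
    _ _ _ (leqnn _)) => [f _ [[srt fh] ba]|].
    by split=> //; split=> // i; rewrite mem_swap; apply: fh.
  apply: sortable_lt_pair => //.
  + by rewrite -(perm_uniq (s1 := [:: a, b & cs])) //
      (perm_catCA [:: a] [:: b]).
  + by apply: sub_all s_cs => i; rewrite mem_swap.
  + by move=> i; rewrite mem_swap; apply: hs.
Qed.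

(** * Counting the weighings *)

Lemma completable_even k cs :
  size cs = k.*2 -> uniq cs -> completable cs (3 * k).
Proof.
elim: k cs => [|k IHk] [|a [|b cs]] //= => [_ _|[sz] cs_uniq].
  exact: completable_nil.
rewrite mulnS; apply: completable_pair => //; apply: IHk => //.
by case/and3P: cs_uniq.
Qed.

Lemma sortable_first_pair cs m (a b : 'I_n) :
  uniq [:: a, b & cs] -> (forall i, i \in [:: a, b & cs]) ->
  completable cs m -> sortable (fun=> True) m.+1.
Proof.
move=> ab_cs all_in cs_m.
have /= /andP[] := ab_cs; rewrite inE negb_or => /andP[ab _] _.
(* No coin is sorted yet, so the conditions on [h] are vacuous and any map will do. *)
pose h : 'I_n -> 'I_n := id.
have hs i : i \notin [:: a, b & cs] -> h i \in [::] by rewrite all_in.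
have s_cs : all (fun i => i \notin [:: a, b & cs]) [::] by [].
have kn f : known [:: a, b & cs] [::] h f by [].
apply: (sortable_weaken (J := known [:: a, b & cs] [::] h) _ (leqnn _)) => //.
apply: (sortable_weigh ab).
- insert [:: a; b] a b.
- insert [:: a] a a.
- insert [:: b; a] a b.
Qed.

(** For [n = 2k + 1] the bound is [3k], three weighings per pair; for [n = 2k] it is [3(k - 1) + 1],
    since the first pair costs only one. *)
Lemma sortable_all : 1 <= n -> sortable (fun=> True) (uphalf (3 * n) - 2).
Proof.
move=> n1.
have [[|a cs] /= [cs_uniq sz all_in]] : exists cs : seq 'I_n,
    [/\ uniq cs, size cs = n & forall i, i \in cs].
- exists (enum 'I_n); rewrite enum_uniq size_enum_ord.
  by split=> // i; rewrite mem_enum.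
- by rewrite -sz in n1.
have [odd_n|even_n] := boolP (odd n).
  case/andP: cs_uniq => a_cs cs_uniq.
  have cs_m : completable cs (3 * n./2) by apply: completable_even => //; lia.
  (* Only [a] counts as sorted, so the constant map sends every sorted coin to its
     representative. *)
  have := cs_m [:: a] (fun=> a) isT; rewrite /= a_cs andbT => /(_ isT).
  move=> /(_ (fun _ _ => mem_head a [::])).
  apply: sortable_weaken => [f _ _|]; last by lia.
  split=> // i i_cs; have := all_in i; rewrite inE (negbTE i_cs) orbF.
  by move/eqP->.
case: cs cs_uniq sz all_in => [|b cs] ab_cs /= sz all_in.
  by rewrite -sz in even_n.
have cs_m : completable cs (3 * n./2.-1).
  by apply: completable_even; [lia | case/and3P: ab_cs].
by apply: sortable_weaken (sortable_first_pair ab_cs all_in cs_m) => //; lia.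
Qed.

End TinyPans.

(* [uphalf k] is the ceiling of k/2; the subtraction is never truncated, since
   [uphalf (3 * n) >= 2] when [n >= 1]. *)
Theorem theorem4p1 (R : realType) (n : nat) (hn : (1 <= n)%N) :
  exists S : strategy n, sorts_in_at_most R S (uphalf (3 * n) - 2)%N.
Proof.
have [S [answer SP]] := sortable_all R hn.
exists S, answer => w1 w2 w3 w12 w23 x xw.
by have [f xf] := rank_exists w12 w23 xw; apply: SP xf I.
Qed.
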